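(* The admissible sets of words on $\{\circ,\bullet\}$ are exactly the following ones: \begin{itemize} \item the empty set; \item $W^{(k)}$, $W^{(\circ,k)}$, $W^{(\bullet,k)}$ for $k\in\mathbf{N}$; \item $W^{(k,k')}=\left\langle W^{(\circ,k)},W^{(\bullet,k')}\right\rangle$ for $k,k'\in\mathbf{N}$. \end{itemize}
   Context: $\mathbf{N}$ denotes the natural numbers. Words are elements of the free monoid on the two letters $\circ,\bullet$. The conjugate of $w=w_1\cdots w_n$ is $\overline{w}=\overline{w}_n\cdots\overline{w}_1$, where $\overline{\circ}=\bullet$, $\overline{\bullet}=\circ$. A set of words is admissible if it is invariant under: concatenation of words; conjugation; cancellation (removal) of a subword (consecutive letters) of the form $\circ\bullet$ or $\bullet\circ$. For words or sets of words, $\langle\cdot\rangle$ denotes the smallest admissible set containing them. The color balance $c(w)$ is the number of $\circ$'s minus the number of $\bullet$'s in $w$, and $w_{\leq l}=w_1\cdots w_l$. Define, for $k>0$, $$W^{(k)}=\{w \mid c(w)= 0 \bmod k\},$$ and, for $0<k\leq\infty$, $$W^{(\circ,k)}=\{w=w_1\cdots w_n \mid c(w)=0 \text{ and } k\geq c(w_{\leq l})\geq 0 \text{ for all } 1\leq l\leq n\},$$ $$W^{(\bullet,k)}=\{w=w_1\cdots w_n \mid c(w)=0 \text{ and } -k\leq c(w_{\leq l})\leq 0 \text{ for all } 1\leq l\leq n\}.$$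
   Formalization: In the sets with one or two bounds, k and k' range over 0, 1, 2, … and ∞, not only over N: the set W^(∘,∞) is admissible but is missing from the list with finite k, and the set containing only the empty word needs k = 0; W^(k) is taken for k > 0. *)

(* Defs.v *)
From HB Require Import structures.
From mathcomp Require Import all_boot all_order all_algebra.
From mathcomp Require Import boolp classical_sets.

Set Implicit Arguments.
Unset Strict Implicit.
Unset Printing Implicit Defensive.

Import Order.TTheory GRing.Theory Num.Theory.
Local Open Scope classical_set_scope.
Local Open Scope ring_scope.

Inductive letter := Circ | Bullet.

Definition bool_of_letter (x : letter) : bool := if x is Circ then true else false.
Definition letter_of_bool (b : bool) : letter := if b then Circ else Bullet.

Lemma bool_of_letterK : cancel bool_of_letter letter_of_bool.
Proof. by case. Qed.

HB.instance Definition _ := Countable.copy letter (can_type bool_of_letterK).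

Definition word := seq letter.

Definition conj_letter (x : letter) : letter := if x is Circ then Bullet else Circ.

Definition conj_word (w : word) : word := rev (map conj_letter w).

Record admissible (S : set word) : Prop := Admissible {
  admissible_cat : forall u v, S u -> S v -> S (u ++ v);
  admissible_conj : forall w, S w -> S (conj_word w);
  admissible_cancel_CB : forall u v, S (u ++ [:: Circ; Bullet] ++ v) -> S (u ++ v);
  admissible_cancel_BC : forall u v, S (u ++ [:: Bullet; Circ] ++ v) -> S (u ++ v)
}.

Definition balance (w : word) : int :=
  (count_mem Circ w)%:Z - (count_mem Bullet w)%:Z.

(* Range of the bounds k: the natural numbers, 0 included, and infinity ([None]).
   Both ends matter: the set of all words with nonnegative prefix balances and
   balance zero is [Wcirc None], and the set containing only the empty word is
   [Wcirc (Some 0)]. *)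
Definition enat := option nat.

Definition le_enat (x : int) (k : enat) : bool :=
  if k is Some n then x <= n%:Z else true.

Definition Wmod (k : nat) : set word :=
  [set w | (balance w = 0 %[mod k%:Z])%Z].

Definition Wcirc (k : enat) : set word :=
  [set w | balance w = 0 /\
    forall l, (1 <= l <= size w)%N ->
      le_enat (balance (take l w)) k /\ 0 <= balance (take l w)].

(* The lower bound -k <= c is written as -c <= k. *)
Definition Wbullet (k : enat) : set word :=
  [set w | balance w = 0 /\
    forall l, (1 <= l <= size w)%N ->
      le_enat (- balance (take l w)) k /\ balance (take l w) <= 0].

(* [smallest C G] is the intersection of all the sets satisfying [C] and
   containing [G]; admissibility is stable under intersection. *)
Definition Wgen (k k' : enat) : set word :=
  smallest admissible (Wcirc k `|` Wbullet k').

(* Main.v *)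
Require Import Defs.
From mathcomp Require Import all_boot all_order all_algebra.
From mathcomp Require Import boolp classical_sets.
From mathcomp Require Import zify.

(** A word is a walk on the integers that starts at 0, goes up at each [Circ]
    and down at each [Bullet]; its balance is the endpoint and the balances of
    its prefixes are the heights that it visits.  An admissible set [S] is
    determined by two sets of integers: the set [B] of the endpoints and the set
    [H] of the heights of its words.  More precisely a nonempty admissible [S]
    consists of all walks that end in [B] and stay in [H]
    ([admissible_confined]).

    The reason is that cancellation straightens walks: any piece of a word of
    [S] may be replaced by the monotone word [mono z] with the same balance [z]
    ([admissible_mono]).  Hence, as soon as a height [h] is visited, the hairpin
    [mono h ++ mono (- h)] is in [S] ([hairpin]).  Hairpins suffice to draw every
    walk inside [H]: if the walk [w], closed up by a straight return to 0, is in
    [S], appending the hairpin of the next height [h'] and straightening the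
    trip from the end of [w] through 0 to [h'] into a single step extends [w]
    by one letter ([closed_walk]).

    It remains to see which pairs [(B, H)] occur.  The set [B] is a subgroup of
    the integers, so it consists of the multiples of some [k], and hairpins show
    that [H] is an interval around 0.  If [k > 0], then [H] contains all
    multiples of [k], so it is everything, and [S] is [Wmod k].  If [k = 0], then
    [H] is the interval from [- k2] to [k1] for some possibly infinite [k1] and
    [k2]; its hairpins are those of [Wcirc k1] and of [Wbullet k2], and [S] is
    [Wgen k1 k2].

    Conversely, the walks that end in a subgroup [B] and stay in a [B]-periodic
    set form an admissible set ([confined_admissible]); this covers [Wmod],
    [Wcirc] and [Wbullet]. *)

Set Implicit Arguments.
Unset Strict Implicit.
Unset Printing Implicit Defensive.

Import Order.TTheory GRing.Theory Num.Theory.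
Local Open Scope classical_set_scope.
Local Open Scope ring_scope.

(** * Walks and their endpoints *)

Lemma balance_cat u v : balance (u ++ v) = balance u + balance v.
Proof. by rewrite /balance !count_cat; lia. Qed.

Lemma balance_conj w : balance (conj_word w) = - balance w.
Proof.
rewrite /balance /conj_word !count_rev !count_map.
have -> : count (preim conj_letter (pred1 Circ)) w = count_mem Bullet w.
  by apply: eq_count; case.
have -> : count (preim conj_letter (pred1 Bullet)) w = count_mem Circ w.
  by apply: eq_count; case.
by lia.
Qed.

(** Conjugation travels the walk backwards, from its endpoint moved to 0. *)
Lemma balance_take_conj l w :
  balance (take l (conj_word w)) = balance (take (size w - l) w) - balance w.
Proof.
rewrite /conj_word take_rev size_map -map_drop -/(conj_word _) balance_conj.
have := congr1 balance (cat_take_drop (size w - l) w).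
by rewrite balance_cat; lia.
Qed.

Definition mono (z : int) : word :=
  match z with Posz n => nseq n Circ | Negz n => nseq n.+1 Bullet end.

Lemma mono_opp (n : nat) : mono (- n%:Z) = nseq n Bullet.
Proof. by case: n. Qed.

Lemma balance_mono z : balance (mono z) = z.
Proof. by case: z => n; rewrite /balance /mono !count_nseq /=; lia. Qed.

Lemma letter_mono x : [:: x] = mono (balance [:: x]).
Proof. by case: x. Qed.

(** * Walks confined to a set of heights *)

Definition confined (B H : set int) : set word :=
  [set w | B (balance w) /\ forall l, H (balance (take l w))].

(** Appending a walk after one that ends at [b] shifts its heights by [b], which
    is why [H] has to be periodic. *)
Lemma confined_admissible (B H : set int) :
    (forall a b, B a -> B b -> B (a - b)) ->
    (forall h b, H h -> B b -> H (h - b)) ->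
  admissible (confined B H).
Proof.
move=> BB HB.
have B_opp b : B b -> B (- b).
  by move=> Bb; rewrite -[- b]add0r -{1}(subrr b); apply: (BB) => //; apply: BB.
have cancel p u v : balance p = 0 -> size p = 2%N ->
  confined B H (u ++ p ++ v) -> confined B H (u ++ v).
  move=> p0 size_p [Bw Hw]; split.
    by move: Bw; rewrite !balance_cat p0 add0r.
  move=> l; case: (ltnP l (size u)) => lu.
    by have := Hw l; rewrite !take_cat lu.
  have := Hw (l + 2)%N; rewrite !take_cat.
  rewrite ifN ?ifN ?size_p; try by lia.
  have -> : (l + 2 - size u - 2 = l - size u)%N by lia.
  by rewrite !balance_cat p0 add0r.
split; [| |by move=> u v; apply: cancel|by move=> u v; apply: cancel].
- move=> u v [Bu Hu] [Bv Hv]; split.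
    by rewrite balance_cat -[balance v]opprK; apply/BB/B_opp.
  move=> l; rewrite take_cat; case: ifP => // _.
  by rewrite balance_cat addrC -[balance u]opprK; apply/HB/B_opp.
- move=> w [Bw Hw]; split; first by rewrite balance_conj; apply: B_opp.
  by move=> l; rewrite balance_take_conj; apply: HB.
Qed.

(** On a closed walk, the prefixes of length 0 or beyond the end visit no height
    other than 0. *)
Lemma confined0E (H : set int) : H 0 ->
  confined [set 0] H =
  [set w | balance w = 0 /\
    forall l, (1 <= l <= size w)%N -> H (balance (take l w))].
Proof.
move=> H0; apply/seteqP; split=> w [w0 Hw]; split=> // l.
case: (posnP l) => [->|l_gt0]; first by rewrite take0.
case: (leqP l (size w)) => [lw|/ltnW wl]; first by apply: Hw; rewrite l_gt0.
by rewrite take_oversize // w0.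
Qed.

Lemma le_enat0 k : le_enat 0 k.
Proof. by case: k. Qed.

Lemma Wmod_confined k :
  Wmod k = confined [set b | (k%:Z %| b)%Z] setT.
Proof.
apply/seteqP; split=> w.
  by move=> /eqP; rewrite eqz_mod_dvd subr0.
by move=> [kw _]; apply/eqP; rewrite eqz_mod_dvd subr0.
Qed.

Lemma Wcirc_confined k :
  Wcirc k = confined [set 0] [set h | le_enat h k /\ 0 <= h].
Proof. by rewrite confined0E //; split=> //; apply: le_enat0. Qed.

Lemma Wbullet_confined k :
  Wbullet k = confined [set 0] [set h | le_enat (- h) k /\ h <= 0].
Proof. by rewrite confined0E //; split=> //; apply: le_enat0. Qed.

Lemma Wmod_admissible k : admissible (Wmod k).
Proof.
by rewrite Wmod_confined; apply: confined_admissible => // a b; apply: rpredB.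
Qed.

Lemma confined0_admissible H : admissible (confined [set 0] H).
Proof.
apply: confined_admissible => [a b -> ->|h b Hh ->]; last by rewrite subr0.
by rewrite /= subr0.
Qed.

Lemma smallest_admissible G : admissible (smallest admissible G).
Proof.
split=> [u v Su Sv|w Sw|u v Suv|u v Suv] T TG; have [cat conj CB BC] := TG.1.
- by apply: cat; [exact: (Su T TG)|exact: (Sv T TG)].
- exact/conj/(Sw T TG).
- exact/CB/(Suv T TG).
- exact/BC/(Suv T TG).
Qed.

(** * An admissible set is determined by its endpoints and heights *)

Section Structure.
Variable S : set word.
Hypothesis admS : admissible S.

Definition endpoints : set int := [set b | exists2 w, S w & balance w = b].

Definition heights : set int :=
  [set h | exists u v, S (u ++ v) /\ balance u = h].

(** Straightening: a letter in front of a monotone word either prolongs it or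
    cancels its first letter, so straightening goes from right to left. *)
Lemma admissible_mono p u q : S (p ++ u ++ q) -> S (p ++ mono (balance u) ++ q).
Proof.
elim: u p => [|x u IHu] p //.
rewrite -cat1s -catA catA => /IHu; rewrite -catA balance_cat.
have -> : balance [:: x] = if x is Circ then 1 else -1 by case: x.
case: (balance u) => [[|n]|n]; case: x => //.
- have -> : -1 + n.+1%:Z = n by lia.
  exact: (admissible_cancel_BC admS).
- have -> : 1 + Negz n = - n%:Z by lia.
  by rewrite mono_opp; apply: (admissible_cancel_CB admS).
Qed.

Lemma endpoint_mono b : endpoints b -> S (mono b).
Proof.
case=> w Sw <-; have := @admissible_mono [::] w [::].
by rewrite !cats0; apply.
Qed.

(** If a word of [S] visits [h], following it and then going back along it is a
    closed walk; straightening it up to the visit of [h], and then after it,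
    gives the hairpin. *)
Lemma hairpin h : heights h -> S (mono h ++ mono (- h)).
Proof.
case=> u [v [Suv <-]].
have := admissible_cat admS Suv (admissible_conj admS Suv).
rewrite -catA => /(@admissible_mono [::]) /=.
rewrite -[v ++ _]cats0 => /admissible_mono; rewrite cats0.
have -> // : balance (v ++ conj_word (u ++ v)) = - balance u.
by rewrite balance_cat balance_conj balance_cat; lia.
Qed.

Lemma heights_pos (n m : nat) : (m <= n)%N -> heights n -> heights m.
Proof.
move=> mn /hairpin; rewrite -{1}(subnKC mn) /= nseqD -catA => Sn.
by exists (mono m), (nseq (n - m) Circ ++ mono (- n%:Z)); rewrite balance_mono.
Qed.

Lemma heights_neg (n m : nat) :
  (m <= n)%N -> heights (- n%:Z) -> heights (- m%:Z).
Proof.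
move=> mn /hairpin; rewrite mono_opp -{1}(subnKC mn) nseqD -catA => Sn.
eexists (mono (- m%:Z)), _; rewrite balance_mono mono_opp.
by split; first exact: Sn.
Qed.

Lemma endpoints_heights b : endpoints b -> heights b.
Proof. by case=> w Sw wb; exists w, [::]; rewrite cats0. Qed.

Lemma endpointsB a b : endpoints a -> endpoints b -> endpoints (a - b).
Proof.
move=> [u Su <-] [v Sv <-]; exists (u ++ conj_word v).
  by apply: (admissible_cat admS) => //; apply: (admissible_conj admS).
by rewrite balance_cat balance_conj.
Qed.

Hypothesis S_neq0 : S !=set0.

Lemma endpoints0 : endpoints 0.
Proof.
case: S_neq0 => w Sw; rewrite -(subrr (balance w)).
by apply: endpointsB; exists w.
Qed.

(** A walk inside [heights], closed up by a straight return to 0, is assembled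
    from the hairpins of the heights that it visits. *)
Lemma closed_walk w : (forall l, heights (balance (take l w))) ->
  S (w ++ mono (- balance w)).
Proof.
elim/last_ind: w => [_|w x IHw Hw]; first exact: endpoint_mono endpoints0.
have {IHw} Sw : S (w ++ mono (- balance w)).
  apply: IHw => l; case: (leqP l (size w)) => [lw|/ltnW wl].
    by have := Hw l; rewrite -cats1 takel_cat.
  by have := Hw (size w); rewrite -cats1 take_size_cat // take_oversize.
have Swx : S (mono (balance (rcons w x)) ++ mono (- balance (rcons w x))).
  by apply: hairpin; have := Hw (size (rcons w x)); rewrite take_size.
have := admissible_cat admS Sw Swx.
rewrite -catA [X in w ++ X]catA => /admissible_mono.
(* From the end of [w] to 0 and on to the end of [rcons w x] is a single step. *)
rewrite balance_cat !balance_mono -{1}cats1 balance_cat addKr -letter_mono.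
by rewrite catA cats1.
Qed.

Theorem admissible_confined : S = confined endpoints heights.
Proof.
apply/seteqP; split=> w.
  move=> Sw; split; first by exists w.
  by move=> l; exists (take l w), (drop l w); rewrite cat_take_drop.
move=> [Bw /closed_walk Sw].
have := admissible_cat admS Sw (endpoint_mono Bw).
rewrite -catA -[_ ++ mono _]cats0 => /admissible_mono.
by rewrite balance_cat !balance_mono addNr !cats0.
Qed.

End Structure.

(** * Subgroups of the integers and initial segments of the naturals *)

Lemma int_subgroup (B : set int) :
    B 0 -> (forall a b, B a -> B b -> B (a - b)) ->
  exists k : nat, forall z, B z <-> (k%:Z %| z)%Z.
Proof.
move=> B0 BB.
have BN b : B b -> B (- b) by move=> Bb; rewrite -[- b]add0r; apply: BB.
have BM b (n : nat) : B b -> B (b * n%:Z).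
  move=> Bb; elim: n => [|n IHn]; first by rewrite mulr0.
  have -> : b * n.+1%:Z = b * n%:Z - - b by lia.
  by apply: BB => //; apply: BN.
have BMz b z : B b -> B (b * z).
  case: z => n Bb; first exact: BM.
  by rewrite NegzE mulrN; apply/BN/BM.
have [[n n_gt0 Bn]|noB] := pselect (exists2 n : nat, (0 < n)%N & B n); last first.
  exists 0%N => z; rewrite dvd0z; split=> [Bz|/eqP-> //].
  apply/negPn/negP => z0; apply: noB; exists `|z|%N; first by lia.
  by case: z z0 Bz => // n _ /BN.
have exP : exists n : nat, (0 < n)%N && `[< B n >].
  by exists n; rewrite n_gt0; apply/asboolP.
case: (ex_minnP exP) => k /andP[k_gt0 /asboolP Bk] k_min {n n_gt0 Bn exP}.
exists k => z; split=> [Bz|/dvdzP[q ->]]; last by rewrite mulrC; apply: BMz.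
have Br : B (z %% k)%Z.
  have -> : (z %% k)%Z = z - k%:Z * (z %/ k)%Z by rewrite {2}(divz_eq z k); lia.
  by apply: BB => //; apply: BMz.
have r_ge0 : 0 <= (z %% k)%Z by apply: modz_ge0; lia.
have r_ltk : (z %% k)%Z < k by apply: ltz_pmod; lia.
apply/dvdz_mod0P; case: (z %% k)%Z r_ge0 r_ltk Br => // r _ rk Br.
case: (posnP r) => [->//|r_gt0].
by have := k_min r; rewrite r_gt0 (asboolT Br) => /(_ isT); lia.
Qed.

Lemma initial_segment (D : set nat) :
    D 0%N -> (forall n m, (m <= n)%N -> D n -> D m) ->
  exists k : enat, forall n : nat, D n <-> le_enat n k.
Proof.
move=> D0 D_le; have [allD|/existsNP[n nDn]] := pselect (forall n, D n).
  by exists None.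
have exP : exists n, ~~ `[< D n >] by exists n; apply/asboolPn.
case: (ex_minnP exP) => k /asboolPn nDk k_min {n nDn exP}.
case: k => [//|k] in nDk k_min *; exists (Some k) => n /=; split=> [Dn|nk].
  by rewrite lez_nat leqNgt; apply/negP => kn; apply: nDk; apply: D_le Dn.
by apply: contrapT => /asboolPn/k_min; lia.
Qed.

(** * The classification *)

Lemma take_hairpin n x l :
  exists2 m, (m <= n)%N &
    balance (take l (nseq n x ++ nseq n (conj_letter x))) = balance (nseq m x).
Proof.
rewrite take_cat size_nseq; case: ltnP => [ln|nl].
  by exists l; [exact: ltnW|rewrite take_nseq // ltnW].
case: (leqP (l - n) n) => lnn; last first.
  exists 0%N => //; rewrite take_oversize ?size_nseq; last exact: ltnW.
  by rewrite balance_cat /balance !count_nseq; case: x => /=; lia.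
exists (n - (l - n))%N; first exact: leq_subr.
rewrite take_nseq // balance_cat /balance !count_nseq.
by case: x => /=; lia.
Qed.

Lemma Wcirc_hairpin k (n : nat) :
  le_enat n k -> Wcirc k (mono n ++ mono (- n%:Z)).
Proof.
move=> nk; rewrite Wcirc_confined.
split; first by rewrite balance_cat !balance_mono subrr.
move=> l; rewrite mono_opp; have [m mn ->] := take_hairpin n Circ l.
rewrite /= (balance_mono m); split=> //.
by case: k nk => //= k; apply: le_trans; rewrite lez_nat.
Qed.

Lemma Wbullet_hairpin k (n : nat) :
  le_enat n k -> Wbullet k (mono (- n%:Z) ++ mono n).
Proof.
move=> nk; rewrite Wbullet_confined.
split; first by rewrite balance_cat !balance_mono addNr.
move=> l; rewrite mono_opp; have [m mn ->] := take_hairpin n Bullet l.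
rewrite -mono_opp /= balance_mono opprK; split; last by lia.
by case: k nk => //= k; apply: le_trans; rewrite lez_nat.
Qed.

(** Every integer lies between 0 and some multiple of [k], and all multiples of
    [k] are visited as endpoints. *)
Lemma admissible_Wmod (S : set word) (k : nat) :
    admissible S -> S !=set0 -> (0 < k)%N ->
    (forall b, endpoints S b <-> (k%:Z %| b)%Z) ->
  S = Wmod k.
Proof.
move=> admS S_neq0 k_gt0 Bk.
rewrite (admissible_confined admS S_neq0) Wmod_confined.
have allH h : heights S h.
  have HM z : heights S (z * k%:Z).
    by apply: endpoints_heights; apply/Bk; apply: dvdz_mull.
  case: h => n.
    apply: (@heights_pos _ admS (n * k)); first by rewrite leq_pmulr.
    by rewrite PoszM.
  rewrite NegzE; apply: (@heights_neg _ admS (n.+1 * k)).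
    by rewrite leq_pmulr.
  by rewrite PoszM -mulNr.
by apply/seteqP; split=> w [Bw _]; split=> //; apply/Bk.
Qed.

(** The generators [Wcirc k] and [Wbullet k'] lie in [S] because their walks stay
    in its heights; they generate it because they contain all of its
    hairpins. *)
Lemma admissible_Wgen (S : set word) (k k' : enat) :
    admissible S -> S !=set0 ->
    (forall b, endpoints S b <-> b = 0) ->
    (forall n : nat, heights S n <-> le_enat n k) ->
    (forall n : nat, heights S (- n%:Z) <-> le_enat n k') ->
  S = Wgen k k'.
Proof.
move=> admS S_neq0 B0 Hk Hk'; have defS := admissible_confined admS S_neq0.
apply/seteqP; split=> [w Sw T [admT GT]|]; last first.
  apply: smallest_sub => // w; rewrite defS Wcirc_confined Wbullet_confined.
  case=> -[w0 Hw]; split; try exact/B0.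
    by move=> l; have [] := Hw l; case: (balance _) => // n /Hk.
  move=> l; have [] := Hw l; case: (balance _) => [n _ n0|n /(Hk' n.+1)//].
  have -> : n = 0%N by lia.
  exact/Hk/le_enat0.
have hairpinT h : heights S h -> T (mono h ++ mono (- h)).
  case: h => n Sn; apply: GT; first by left; apply/Wcirc_hairpin/Hk.
  by right; rewrite NegzE opprK; apply/Wbullet_hairpin/Hk'; rewrite -NegzE.
have T_neq0 : T !=set0.
  by exists [::]; apply: (hairpinT 0); apply/Hk; apply: le_enat0.
move: Sw; rewrite (admissible_confined admT T_neq0) defS => -[/B0 w0 Hw].
split; first by rewrite w0; apply: endpoints0.
move=> l; exists (mono (balance (take l w))), (mono (- balance (take l w))).
by rewrite balance_mono; split=> //; apply: hairpinT.
Qed.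

Theorem theorem5p10 (S : set word) :
  admissible S <->
    (S = set0
     \/ (exists k : nat, (0 < k)%N /\ S = Wmod k)
     \/ (exists k : enat, S = Wcirc k)
     \/ (exists k : enat, S = Wbullet k)
     \/ (exists k k' : enat, S = Wgen k k')).
Proof.
split; last first.
  case=> [->|[[k [_ ->]]|[[k ->]|[[k ->]|[k [k' ->]]]]]].
  - by split.
  - exact: Wmod_admissible.
  - by rewrite Wcirc_confined; apply: confined0_admissible.
  - by rewrite Wbullet_confined; apply: confined0_admissible.
  - exact: smallest_admissible.
move=> admS; have [->|/set0P S_neq0] := eqVneq S set0; [by left|right].
have B0 := endpoints0 admS S_neq0.
have H0 : heights S 0 by apply: endpoints_heights.
have [k Bk] := int_subgroup B0 (endpointsB admS).
case: (posnP k) => [k0|k_gt0]; last first.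
  by left; exists k; split=> //; apply: admissible_Wmod.
do 3!right.
have [k1 Hk1] := initial_segment (D := fun n : nat => heights S n) H0
  (heights_pos admS).
have [k2 Hk2] := initial_segment (D := fun n : nat => heights S (- n%:Z)) H0
  (heights_neg admS).
exists k1, k2; apply: admissible_Wgen => // b.
by rewrite Bk k0 dvd0z; split=> /eqP.
Qed.
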